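(* For all sequences $\mathbf n=(n_1,n_2,\dots)$ of positive integers there exists a unit vector $\vec\ell_{\mathbf n}\in\mathcal C_{-,-,+}$ such that for all $\vec w\in\mathcal C_{-,-,+}$, $$\lim_{k\to\infty}\frac{(A^{(k)})^{-T}(\vec w)}{\|(A^{(k)})^{-T}(\vec w)\|_2}=\vec\ell_{\mathbf n}.$$ In addition, if $\Phi^{(k)}$ is the stable eigen-covector of the finite product $A^{(k)}$, then $\Phi^{(k)}\to\Phi_{\mathbf n}$ as $k\to\infty$, where $\Phi_{\mathbf n}(\vec w)=\vec\ell_{\mathbf n}\cdot\vec w$.
   Context: For a positive integer $n$ let $A_n=\begin{pmatrix}0&n+1&n\\1&0&0\\0&1&1\end{pmatrix}$, and for $\mathbf n=(n_1,n_2,\dots)$ let $A^{(k)}=A_{n_1}A_{n_2}\cdots A_{n_k}$. $M^{-T}$ denotes the inverse transpose of $M$. $\mathcal C_{-,-,+}=\{x\in\mathbb R^3:x_1<0,\ x_2<0,\ x_3>0\}$. The stable eigen-covector of $A^{(k)}$ is the linear functional $\Phi^{(k)}(\vec w)=\vec m^{(k)}\cdot\vec w$, where $\vec m^{(k)}$ is the unit length left eigenvector of $A^{(k)}$, lying in $\mathcal C_{-,-,+}$, for the eigenvalue $\lambda\in(0,1)$ of $A^{(k)}$ of smallest modulus (i.e. $(A^{(k)})^T\vec m^{(k)}=\lambda\,\vec m^{(k)}$). *)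

(* Defs.v *)
From HB Require Import structures.
From mathcomp Require Import all_boot all_order all_algebra.
From mathcomp Require Import all_classical all_reals all_analysis.
From mathcomp.real_closed Require Import complex.

Set Implicit Arguments.
Unset Strict Implicit.
Unset Printing Implicit Defensive.

Import Order.TTheory GRing.Theory Num.Theory.
Import numFieldNormedType.Exports.
Local Open Scope classical_set_scope.
Local Open Scope ring_scope.

Definition matA (R : realType) (n : nat) : 'M[R]_3 :=
  \matrix_(i < 3, j < 3)
    nth 0 (nth [::] [:: [:: 0; n.+1%:R; n%:R];
                        [:: 1; 0;       0   ];
                        [:: 0; 1;       1   ]] i) j.

(* Sequences are indexed from 0: [n i] is the entry n_(i+1) of (n_1, n_2, ...),
   so that [prodA n k] is the product A_(n_1) A_(n_2) ... A_(n_k), in this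
   order. *)
Definition prodA (R : realType) (n : nat -> nat) (k : nat) : 'M[R]_3 :=
  \prod_(i < k) matA R (n i).

Definition inv_transpose (R : realType) (M : 'M[R]_3) : 'M[R]_3 := (invmx M)^T.

Definition dot (R : realType) (u v : 'cV[R]_3) : R := \sum_(i < 3) u i 0 * v i 0.

(* The library norm on matrices is the sup norm; this is the Euclidean one. *)
Definition norm2 (R : realType) (v : 'cV[R]_3) : R := Num.sqrt (dot v v).

Definition normalize (R : realType) (v : 'cV[R]_3) : 'cV[R]_3 :=
  (norm2 v)^-1 *: v.

Definition cone_mmp (R : realType) : set 'cV[R]_3 :=
  [set x | [/\ x 0 0 < 0, x 1 0 < 0 & 0 < x 2%:R 0]].

(* [lam] is a real eigenvalue of minimal modulus among all the complex
   eigenvalues of [M]. *)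
Definition smallest_modulus_eigenvalue (R : realType) (M : 'M[R]_3) (lam : R) :
    Prop :=
  eigenvalue M lam /\
  forall z : R[i], eigenvalue (map_mx (real_complex R) M) z ->
    `|real_complex R lam| <= `|z|.

Definition is_stable_eigenvector (R : realType) (M : 'M[R]_3) (m : 'cV[R]_3) :
    Prop :=
  exists lam : R,
    [/\ 0 < lam < 1, smallest_modulus_eigenvalue M lam, M^T *m m = lam *: m,
        norm2 m = 1 & cone_mmp m].

(* Definite description. If there is no such eigenvector (as for the empty
   product [prodA n 0], the identity) the value is 0, which is at distance 1
   from every unit vector. *)
Definition stable_eigenvector (R : realType) (M : 'M[R]_3) : 'cV[R]_3 :=
  xget 0 [set m | is_stable_eigenvector M m].

Definition stable_covector (R : realType) (M : 'M[R]_3) : 'cV[R]_3 -> R :=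
  dot (stable_eigenvector M).

Definition unit_ball2 (R : realType) : set 'cV[R]_3 := [set w | norm2 w <= 1].

(* Main.v *)
(** Conjugating by diag(-1,-1,1) turns A_n^(-T) into the nonnegative matrix
    B_n = [[0,1,1],[1,0,0],[0,n,n+1]] and the cone C_(-,-,+) into the positive
    orthant. A product of three of the B_n is within a factor, independent of
    the indices, of a rank one positive matrix, so every third step contracts
    by 2/3 the interval containing the ratios of two rows of
    B_(n_1) ... B_(n_k). Hence the image of the positive orthant shrinks to a
    single ray, uniformly. Applied to the periodic sequence of period k, this
    produces a Perron eigenvector of A^(k)^(-T), which is the stable eigenvector
    of A^(k); being a normalized point of the image of the cone under
    A^(k)^(-T), it converges to the same direction. *)
Require Import Defs.
From HB Require Import structures.
From mathcomp Require Import all_boot all_order all_algebra.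
From mathcomp Require Import all_classical all_reals all_analysis.
From mathcomp.real_closed Require Import complex.
From mathcomp Require Import ring lra.
Import Order.TTheory GRing.Theory Num.Theory.
Import numFieldNormedType.Exports.
Local Open Scope classical_set_scope.
Local Open Scope ring_scope.

(** * Coordinates in dimension three *)

Lemma ord3P (P : 'I_3 -> Prop) : P 0 -> P 1 -> P 2%:R -> forall i, P i.
Proof.
move=> P0 P1 P2; case=> [[|[|[|//]]] Hi].
- by have -> : Ordinal Hi = 0 by apply: val_inj.
- by have -> : Ordinal Hi = 1 by apply: val_inj.
- by have -> : Ordinal Hi = 2%:R by apply: val_inj.
Qed.

Lemma sum3 (V : nmodType) (F : 'I_3 -> V) :
  \sum_(i < 3) F i = F 0 + F 1 + F 2%:R.
Proof.
rewrite !big_ord_recr big_ord0 /= add0r; congr (_ + _ + _);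
by congr F; apply: val_inj.
Qed.

(** * Conjugation of the inverse transposes to nonnegative matrices *)

Definition signs (R : realType) : 'M[R]_3 :=
  diag_mx (\row_(i < 3) (if (i < 2)%N then -1 else 1)).

(* The conjugate by [signs] of the inverse transpose of [matA R n]. *)
Definition matB (R : realType) (n : nat) : 'M[R]_3 :=
  \matrix_(i < 3, j < 3)
    nth 0 (nth [::] [:: [:: 0; 1;    1      ];
                        [:: 1; 0;    0      ];
                        [:: 0; n%:R; n.+1%:R]] i) j.

Definition prodB (R : realType) (n : nat -> nat) (k : nat) : 'M[R]_3 :=
  \prod_(i < k) matB R (n i).

Lemma signs_coord (R : realType) (w : 'cV[R]_3) i :
  (signs R *m w) i 0 = (if (i < 2)%N then -1 else 1) * w i 0.
Proof. by rewrite mul_diag_mx !mxE. Qed.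

Lemma signsK (R : realType) : signs R *m signs R = 1%:M.
Proof.
apply/matrixP=> i j; rewrite mul_diag_mx !mxE.
by case: ifP; case: eqP => _ _; rewrite /= ?(mulrN1, opprK, mulr0, mul1r).
Qed.

Lemma cone_mmpE (R : realType) (w : 'cV[R]_3) :
  cone_mmp w <-> forall i, 0 < (signs R *m w) i 0.
Proof.
split=> [[w0 w1 w2]|w_gt0].
  by apply: ord3P; rewrite signs_coord/= ?mulN1r ?mul1r ?oppr_gt0.
by split; [move: (w_gt0 0)|move: (w_gt0 1)|move: (w_gt0 2%:R)];
  rewrite signs_coord/= ?mulN1r ?mul1r ?oppr_gt0.
Qed.

(** A single explicit product gives both the invertibility of A_n and its inverse. *)
Lemma matA_inv (R : realType) (n : nat) :
  (signs R *m matB R n *m signs R)^T *m matA R n = 1%:M.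
Proof.
have -> : (signs R *m matB R n *m signs R) =
  \matrix_(i < 3, j < 3)
    nth 0 (nth [::] [:: [:: 0; 1;       -1     ];
                        [:: 1; 0;       0      ];
                        [:: 0; - n%:R; n.+1%:R]] i) j.
  apply/matrixP; apply: ord3P; apply: ord3P;
  by rewrite mul_mx_diag mul_diag_mx !mxE /=; ring.
apply/matrixP; apply: ord3P; apply: ord3P; rewrite !mxE sum3 !mxE /= ?natr1;
  by ring.
Qed.

Lemma inv_transpose_matA (R : realType) (n : nat) :
  matA R n \in unitmx /\
  inv_transpose (matA R n) = signs R *m matB R n *m signs R.
Proof.
have inv := matA_inv R n; have [_ uA] := mulmx1_unit inv; split=> //.
rewrite /inv_transpose -[X in X^T]mul1mx -inv -(mulmxA _ (matA R n)) mulmxV // mulmx1.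
exact: trmxK.
Qed.

Lemma prodAS (R : realType) n k : prodA R n k.+1 = prodA R n k *m matA R (n k).
Proof. by rewrite /prodA big_ord_recr. Qed.

Lemma prodBS (R : realType) n k : prodB R n k.+1 = prodB R n k *m matB R (n k).
Proof. by rewrite /prodB big_ord_recr. Qed.

Lemma unitmx_prodA (R : realType) n k : prodA R n k \in unitmx.
Proof.
elim: k => [|k IH]; first by rewrite /prodA big_ord0 unitmx1.
by rewrite prodAS unitmx_mul IH; have [->] := inv_transpose_matA R (n k).
Qed.

(** Inversion and transposition each reverse products, so their composite keeps the order of the
    factors; the A and B products therefore run in the same order. *)
Lemma inv_transposeM (R : realType) (M N : 'M[R]_3) :
  M \in unitmx -> N \in unitmx ->
  inv_transpose (M *m N) = inv_transpose M *m inv_transpose N.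
Proof.
move=> uM uN; rewrite /inv_transpose -trmx_mul; congr (_^T).
have uMN : M *m N \in unitmx by rewrite unitmx_mul uM.
rewrite -[RHS](mulKmx uMN) -mulmxA (mulmxA N) mulmxV // mul1mx.
by rewrite mulmxV // mulmx1.
Qed.

Lemma inv_transpose_prodA (R : realType) n k :
  inv_transpose (prodA R n k) = signs R *m prodB R n k *m signs R.
Proof.
elim: k => [|k IH].
  rewrite /prodA /prodB !big_ord0 /inv_transpose invmx1 trmx1.
  by rewrite mulmx1 signsK.
have [uA eA] := inv_transpose_matA R (n k).
rewrite prodAS prodBS inv_transposeM ?unitmx_prodA // IH eA !mulmxA.
by rewrite -(mulmxA _ (signs R) (signs R)) signsK mulmx1.
Qed.

(** * Positivity and near rank one of products of three factors *)

Lemma matB_ge0 (R : realType) n i j : 0 <= matB R n i j.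
Proof. by move: i j; apply: ord3P; apply: ord3P; rewrite mxE /=. Qed.

(** The column sums are 1, n + 1 and n + 2. This lets a lower bound 1 on all entries survive
    multiplication by [matB] on the right. *)
Lemma matB_col_ge1 (R : realType) n j : (0 < n)%N -> 1 <= \sum_i matB R n i j.
Proof.
move=> n_gt0; have : 1 <= n%:R :> R by rewrite ler1n.
by move: j; apply: ord3P; rewrite sum3 !mxE /= -?natr1; lra.
Qed.

Lemma matB3E (R : realType) l m n :
  matB R l *m (matB R m *m matB R n) =
  \matrix_(i < 3, j < 3)
    nth 0 (nth [::] [:: [:: m%:R; m.+1%:R * n%:R + 1; m.+1%:R * n.+1%:R + 1];
                        [:: 1; n%:R; n.+1%:R];
                        [:: l.+1%:R * m%:R;
                            l.+1%:R * m.+1%:R * n%:R + l%:R;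
                            l.+1%:R * m.+1%:R * n.+1%:R + l%:R]] i) j.
Proof.
apply/matrixP; apply: ord3P; apply: ord3P; rewrite !(mxE, sum3) /= -?natr1;
  by ring.
Qed.

(* [matB l * matB m * matB n] is within a factor 2 of the rank one matrix
   [v u] with [v = (m+1, 1, (l+1)(m+1))] and [u = (1, n, n+1)]. The factor does
   not depend on [l], [m], [n], whence uniform contraction. *)
Lemma matB3_rank1 (R : realType) l m n :
  (0 < l)%N -> (0 < m)%N -> (0 < n)%N ->
  exists v u : 'I_3 -> R,
  [/\ forall i, 0 < v i, forall j, 0 < u j &
    forall i j, let M := matB R l *m (matB R m *m matB R n) in
      2^-1 * (v i * u j) <= M i j <= 3 / 2 * (v i * u j)].
Proof.
move=> l0 m0 n0.
exists (fun i => nth 0 [:: m.+1%:R; 1; l.+1%:R * m.+1%:R] (i : 'I_3)).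
exists (fun j => nth 0 [:: 1; n%:R; n.+1%:R] (j : 'I_3)).
split.
- by apply: ord3P => //=; rewrite mulr_gt0.
- by apply: ord3P => //=; rewrite ltr0n.
rewrite /= matB3E; have hl : 1 <= l%:R :> R by rewrite ler1n.
have hm : 1 <= m%:R :> R by rewrite ler1n.
have hn : 1 <= n%:R :> R by rewrite ler1n.
(* The required bounds are polynomial in l, m, n; these signs of products of l - 1, m - 1, n - 1
   make them linear consequences. *)
have hlm : 0 <= (l%:R - 1) * (m%:R - 1) :> R by rewrite mulr_ge0 // subr_ge0.
have hln : 0 <= (l%:R - 1) * (n%:R - 1) :> R by rewrite mulr_ge0 // subr_ge0.
have hmn : 0 <= (m%:R - 1) * (n%:R - 1) :> R by rewrite mulr_ge0 // subr_ge0.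
have hlmn : 0 <= (l%:R - 1) * (m%:R - 1) * (n%:R - 1) :> R.
  by rewrite mulr_ge0 // subr_ge0.
by apply: ord3P; apply: ord3P; rewrite !mxE /= -?(natr1 _ l) -?(natr1 _ m)
  -?(natr1 _ n); apply/andP; split; lra.
Qed.

(** The explicit product of three factors has all entries at least 1, and each further factor has
    column sums at least 1. *)
Lemma prodB_ge1 (R : realType) (n : nat -> nat) k i j :
  (forall i, 0 < n i)%N -> (3 <= k)%N -> 1 <= prodB R n k i j.
Proof.
move=> n_gt0; elim: k i j => // k IH i j; rewrite ltnS leq_eqVlt.
case/orP=> [/eqP <-|k3].
  rewrite !prodBS /prodB big_ord0 mul1mx -mulmxA matB3E.
  have := n_gt0 0%N; have := n_gt0 1%N; have := n_gt0 2%N.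
  rewrite -!(ler1n R); move: (n 0%N) (n 1%N) (n 2%N) => l m p hp hm hl.
  have hlm : 0 <= (l%:R - 1) * (m%:R - 1) :> R by rewrite mulr_ge0 ?subr_ge0.
  have hmp : 0 <= (m%:R - 1) * (p%:R - 1) :> R by rewrite mulr_ge0 ?subr_ge0.
  have hlmp : 0 <= l%:R * m%:R * p%:R :> R by rewrite !mulr_ge0.
  have hlp : 0 <= l%:R * p%:R :> R by rewrite !mulr_ge0.
  by move: i j; apply: ord3P; apply: ord3P; rewrite !mxE /= -?natr1; lra.
rewrite prodBS mxE (le_trans (matB_col_ge1 R _ j (n_gt0 k))) //.
apply: ler_sum => a _; rewrite -[leLHS]mul1r ler_wpM2r ?matB_ge0 //.
exact: IH.
Qed.

(* Every column of [D] is up to a factor 3 the same probability weight [v], so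
   every average of [z / y] by a column dominates a third of the average by
   [v]. *)
Lemma column_average_ge (R : realType) (D : 'M[R]_3) (v u y z : 'I_3 -> R) j :
  (forall i, 0 < v i) -> (forall j, 0 < u j) ->
  (forall i j, 2^-1 * (v i * u j) <= D i j <= 3 / 2 * (v i * u j)) ->
  (forall i, 0 < y i) -> (forall i, 0 <= z i) ->
  (\sum_i v i * z i) / (3 * \sum_i v i * y i) * (\sum_i y i * D i j) <=
    \sum_i z i * D i j.
Proof.
move=> v_gt0 u_gt0 hD y_gt0 z_ge0.
set Z := \sum_i v i * z i; set Y := \sum_i v i * y i.
have Y_gt0 : 0 < Y by rewrite /Y sum3 !addr_gt0 // mulr_gt0.
have Z_ge0 : 0 <= Z by apply: sumr_ge0 => i _; rewrite mulr_ge0 // ltW.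
have hy : \sum_i y i * D i j <= 3 / 2 * u j * Y.
  rewrite /Y mulr_sumr; apply: ler_sum => i _.
  have /andP[_ h] := hD i j.
  rewrite (le_trans (ler_wpM2l (ltW (y_gt0 i)) h)) //.
  by rewrite le_eqVlt; apply/orP; left; apply/eqP; ring.
have hz : 2^-1 * u j * Z <= \sum_i z i * D i j.
  rewrite /Z mulr_sumr; apply: ler_sum => i _.
  have /andP[h _] := hD i j.
  rewrite (le_trans _ (ler_wpM2l (z_ge0 i) h)) //.
  by rewrite le_eqVlt; apply/orP; left; apply/eqP; ring.
apply: le_trans hz; apply: le_trans (ler_wpM2l _ hy) _.
  by rewrite divr_ge0 // mulr_ge0 // ltW.
rewrite le_eqVlt; apply/orP; left; apply/eqP; field.
by rewrite gt_eqF.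
Qed.

(** * Contraction of row ratios and the limit direction *)

(** The quotient bounds are multiplied out: in this linear form they pass to nonnegative
    combinations of columns. *)
Definition ratio_in (R : realType) (M : 'M[R]_3) (r s : 'I_3) (lo hi : R) :=
  forall j, lo * M s j <= M r j <= hi * M s j.
Arguments ratio_in {R}.

(** The width [p] serves two uses: 3 for a further matrix factor, 1 for a vector of the orthant. *)
Lemma ratio_in_mul (R : realType) p (M : 'M[R]_3) (B : 'M[R]_(3, p)) r s lo hi :
  (forall i j, 0 <= B i j) -> ratio_in M r s lo hi ->
  forall j, lo * (M *m B) s j <= (M *m B) r j <= hi * (M *m B) s j.
Proof.
move=> B_ge0 hM j; rewrite !mxE !mulr_sumr; apply/andP; split;
  apply: ler_sum => i _; rewrite mulrA ler_wpM2r //;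
  by have /andP[] := hM i.
Qed.

(** Each endpoint moves inward by a third of the [v]-weighted mean of its gap to row [r], relative
    to row [s]. The two gaps add up to (hi - lo) times row [s], so the two shifts add up to (hi -
    lo) / 3. *)
Lemma ratio_in_contract (R : realType) (M D : 'M[R]_3) (v u : 'I_3 -> R)
    r s lo hi :
  (forall i, 0 < v i) -> (forall j, 0 < u j) ->
  (forall i j, 2^-1 * (v i * u j) <= D i j <= 3 / 2 * (v i * u j)) ->
  (forall j, 0 < M s j) -> ratio_in M r s lo hi ->
  exists lo' hi', hi' - lo' = 2 / 3 * (hi - lo) /\ ratio_in (M *m D) r s lo' hi'.
Proof.
move=> v_gt0 u_gt0 hD M_gt0 hM.
set Y := \sum_i v i * M s i.
have Y_gt0 : 0 < Y by rewrite /Y sum3 !addr_gt0 // mulr_gt0.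
pose x i := M r i - lo * M s i; pose x' i := hi * M s i - M r i.
exists (lo + (\sum_i v i * x i) / (3 * Y)), (hi - (\sum_i v i * x' i) / (3 * Y)).
split.
  have -> : \sum_i v i * x i = (\sum_i v i * M r i) - lo * Y.
    by rewrite /Y mulr_sumr -sumrB; apply: eq_bigr => i _; rewrite /x; ring.
  have -> : \sum_i v i * x' i = hi * Y - (\sum_i v i * M r i).
    by rewrite /Y mulr_sumr -sumrB; apply: eq_bigr => i _; rewrite /x'; ring.
  by field; rewrite gt_eqF.
move=> j.
have x_ge0 i : 0 <= x i by rewrite subr_ge0; have /andP[] := hM i.
have x'_ge0 i : 0 <= x' i by rewrite subr_ge0; have /andP[] := hM i.
have := column_average_ge R D v u (M s) x j v_gt0 u_gt0 hD M_gt0 x_ge0.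
have := column_average_ge R D v u (M s) x' j v_gt0 u_gt0 hD M_gt0 x'_ge0.
have -> : \sum_i x i * D i j = (M *m D) r j - lo * (M *m D) s j.
  by rewrite !mxE mulr_sumr -sumrB; apply: eq_bigr => i _; rewrite /x; ring.
have -> : \sum_i x' i * D i j = hi * (M *m D) s j - (M *m D) r j.
  by rewrite !mxE mulr_sumr -sumrB; apply: eq_bigr => i _; rewrite /x'; ring.
have -> : \sum_i M s i * D i j = (M *m D) s j by rewrite mxE.
rewrite -/Y mulrDl mulrBl => h1 h2; apply/andP; split; lra.
Qed.

Lemma prodB_ratio_mono (R : realType) n k k' r s (lo hi : R) :
  (k <= k')%N -> ratio_in (prodB R n k) r s lo hi ->
  ratio_in (prodB R n k') r s lo hi.
Proof.
move=> /subnK <-; elim: (k' - k)%N => [//|d IH] h.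
by rewrite addSn prodBS => j; apply: ratio_in_mul (IH h) j; exact: matB_ge0.
Qed.

Lemma prodB_ratio_small (R : realType) n r s (e : R) :
  (forall i, 0 < n i)%N -> 0 < e ->
  exists k lo hi, [/\ (3 <= k)%N, ratio_in (prodB R n k) r s lo hi & hi - lo < e].
Proof.
move=> n_gt0 e_gt0.
have P_gt0 k i j : (3 <= k)%N -> 0 < prodB R n k i j.
  by move=> k3; rewrite (lt_le_trans ltr01) ?prodB_ge1.
(* The sum of the three column ratios bounds each of them, so [0, h0] is a valid interval at k = 3,
   where all entries are positive. *)
pose h0 : R := \sum_j prodB R n 3 r j / prodB R n 3 s j.
suff step : forall d, exists lo hi, hi - lo = (2 / 3) ^+ d * h0 /\
    ratio_in (prodB R n (3 + 3 * d)%N) r s lo hi.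
  have : (fun d => (2 / 3) ^+ d * h0) @ \oo --> (0 : R).
    rewrite -(mul0r h0); apply: cvgM; last exact: cvg_cst.
    by apply: cvg_expr; rewrite ger0_norm; lra.
  move=> /cvgrPdist_lt /(_ e e_gt0) [d _ /(_ d (leqnn d))] /=.
  rewrite sub0r normrN => hd; have [lo [hi [eq hlh]]] := step d.
  exists (3 + 3 * d)%N, lo, hi; split=> //.
  by rewrite eq (le_lt_trans (ler_norm _)).
elim=> [|d [lo [hi [eq h]]]].
  exists 0, h0; rewrite subr0 expr0 mul1r; split=> // j.
  rewrite mul0r ltW ?P_gt0 //= -ler_pdivrMr ?P_gt0 //.
  rewrite /h0 (bigD1 j) //= lerDl sumr_ge0 // => i _.
  by rewrite divr_ge0 // ltW // P_gt0.
set k := (3 + 3 * d)%N in h *.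
have [v [u [v_gt0 u_gt0 hD]]] :=
  matB3_rank1 R _ _ _ (n_gt0 k) (n_gt0 k.+1) (n_gt0 k.+2).
have M_gt0 j : 0 < prodB R n k s j by rewrite P_gt0.
have [lo' [hi' [eq' h']]] :=
  ratio_in_contract R _ _ v u r s lo hi v_gt0 u_gt0 hD M_gt0 h.
exists lo', hi'; rewrite eq' eq exprS mulrA; split=> //.
by rewrite mulnS [(3 + _)%N]/= 3!prodBS -!mulmxA.
Qed.

(** Intervals valid at different indices meet, as both stay valid at the larger index. The supremum
    of all lower endpoints thus lies in every interval. *)
Lemma prodB_ratio_limit (R : realType) n r s : (forall i, 0 < n i)%N ->
  exists2 t : R, 0 < t & forall lo hi k, (3 <= k)%N ->
    ratio_in (prodB R n k) r s lo hi -> lo <= t <= hi.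
Proof.
move=> n_gt0.
have P_gt0 k i j : (3 <= k)%N -> 0 < prodB R n k i j.
  by move=> k3; rewrite (lt_le_trans ltr01) ?prodB_ge1.
pose E := [set lo : R | exists k hi, (3 <= k)%N /\ ratio_in (prodB R n k) r s lo hi].
have le_lo_hi lo hi k : (3 <= k)%N -> ratio_in (prodB R n k) r s lo hi ->
    ubound E hi.
  move=> k3 h lo' [k' [hi' [k3' h']]].
  have km : (3 <= maxn k k')%N by rewrite leq_max k3.
  have /(_ 0)/andP[_ h1] := prodB_ratio_mono R n _ _ r s _ _ (leq_maxl k k') h.
  have /(_ 0)/andP[h2 _] := prodB_ratio_mono R n _ _ r s _ _ (leq_maxr k k') h'.
  by have := le_trans h2 h1; rewrite ler_pM2r ?P_gt0.
(* At k = 3 each entry lies between 1 and its row sum, so [1/S, T] is a valid interval; 1/S > 0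
   makes the limit positive. *)
pose S := \sum_j prodB R n 3 s j; pose T := \sum_j prodB R n 3 r j.
have S_gt0 : 0 < S by rewrite /S sum3 !addr_gt0 ?P_gt0.
have T_gt0 : 0 < T by rewrite /T sum3 !addr_gt0 ?P_gt0.
have le_sum j i : prodB R n 3 i j <= \sum_j prodB R n 3 i j.
  by rewrite (bigD1 j) //= lerDl sumr_ge0 // => l _; rewrite ltW ?P_gt0.
have h3 : ratio_in (prodB R n 3) r s S^-1 T.
  move=> j; rewrite ler_pdivrMl //; apply/andP; split.
    rewrite (le_trans (le_sum j s)) // -[leLHS]mulr1 ler_wpM2l ?prodB_ge1 //.
    exact: ltW.
  rewrite (le_trans (le_sum j r)) // -[leLHS]mulr1 ler_wpM2l ?prodB_ge1 //.
  exact: ltW.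
have bE : has_ubound E by exists T; apply: le_lo_hi h3.
have ES : E S^-1 by exists 3%N, T.
exists (sup E).
  apply: (@lt_le_trans _ _ S^-1); first by rewrite invr_gt0.
  exact: ub_le_sup.
move=> lo hi k k3 h; apply/andP; split.
  by apply: ub_le_sup => //; exists k, hi.
apply: ge_sup; first by exists S^-1.
exact: le_lo_hi h.
Qed.

(* Uniformity in [w] is what makes the stable eigenvectors, which depend on [k],
   converge to the same limit. *)
Lemma prodB_direction (R : realType) n : (forall i, 0 < n i)%N ->
  exists t : 'I_3 -> R, (forall r, 0 < t r) /\
  forall e : R, 0 < e -> \forall k \near \oo, forall (r : 'I_3) (w : 'cV[R]_3),
    (forall i, 0 < w i 0) -> let u := prodB R n k *m w in
    0 < u 2%:R 0 /\ `|u r 0 / u 2%:R 0 - t r| < e.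
Proof.
move=> n_gt0.
have H r := prodB_ratio_limit R n r 2%:R n_gt0.
pose t r : R := s2val (cid2 (H r)); exists t; split.
  by move=> r; rewrite /t; case: (cid2 (H r)).
(* Only three rows occur, so a threshold may be found for each [r] separately. *)
move=> e e_gt0; apply: filter_forall => r /=.
have [K [lo [hi [K3 hK hlt]]]] := prodB_ratio_small R n r 2%:R e n_gt0 e_gt0.
have /andP[lot thi] : lo <= t r <= hi.
  by rewrite /t; case: (cid2 (H r)) => t' _ /= /(_ _ _ _ K3 hK).
exists K => // k /= Kk w w_gt0.
have k3 := leq_trans K3 Kk.
have u_gt0 i : 0 < (prodB R n k *m w) i 0.
  have P_gt0 j : 0 < prodB R n k i j by rewrite (lt_le_trans ltr01) ?prodB_ge1.
  by rewrite mxE sum3 !addr_gt0 // mulr_gt0.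
split; first exact: u_gt0.
have w_ge0 i j : 0 <= w i j by rewrite (ord1 j) ltW.
have /andP[h1 h2] := ratio_in_mul R 1 _ w r 2%:R lo hi w_ge0
  (prodB_ratio_mono R n _ _ r 2%:R _ _ Kk hK) 0.
rewrite -ler_pdivlMr // in h1; rewrite -ler_pdivrMr // in h2.
by rewrite ltr_norml; lra.
Qed.

(** * Continuity of the Euclidean normalization *)

Lemma cvg_coord (R : realType) T (F : set_system T) {FF : Filter F}
    (f : T -> 'cV[R]_3) (l : 'cV[R]_3) :
  (forall i, f x i 0 @[x --> F] --> l i 0) -> f x @[x --> F] --> l.
Proof.
move=> fl; apply/cvg_ballP => e e_gt0.
have : \forall x \near F, forall i, ball (l i 0) e (f x i 0).
  by apply: filter_forall => i; apply: cvg_ball (fl i) _ e_gt0.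
by apply: filterS => x hx; split=> // i j; rewrite (ord1 j).
Qed.

Lemma mulmx_continuous (R : realType) (Q : 'M[R]_3) :
  continuous (fun w : 'cV[R]_3 => Q *m w).
Proof.
move=> w; apply: (@cvg_coord R _ _ (nbhs_filter w) (mulmx Q)) => i; rewrite [X in _ --> X]mxE sum3.
under eq_fun do rewrite mxE sum3.
by apply: cvgD; [apply: cvgD|]; apply: cvgM;
  solve [exact: cvg_cst | exact: coord_continuous].
Qed.

Lemma dotvv_gt0 (R : realType) (v : 'cV[R]_3) : v != 0 -> 0 < dot v v.
Proof.
move=> v0; have dot_ge0 : 0 <= dot v v.
  by apply: sumr_ge0 => i _; rewrite -expr2 sqr_ge0.
rewrite lt_neqAle dot_ge0 andbT eq_sym.
apply: contra_neq v0 => /psumr_eq0P h.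
apply/matrixP => i j; rewrite (ord1 j) mxE; apply/eqP.
by rewrite -sqrf_eq0 expr2 h // => k _; rewrite -expr2 sqr_ge0.
Qed.

Lemma norm2_gt0 (R : realType) (v : 'cV[R]_3) : v != 0 -> 0 < norm2 v.
Proof. by move=> v0; rewrite sqrtr_gt0 dotvv_gt0. Qed.

Lemma norm2Z (R : realType) c (v : 'cV[R]_3) :
  0 <= c -> norm2 (c *: v) = c * norm2 v.
Proof.
move=> c_ge0; rewrite /norm2.
have -> : dot (c *: v) (c *: v) = c ^+ 2 * dot v v.
  by rewrite /dot mulr_sumr; apply: eq_bigr => i _; rewrite !mxE; ring.
by rewrite sqrtrM ?sqr_ge0 // sqrtr_sqr ger0_norm.
Qed.

Lemma normalizeZ (R : realType) c (v : 'cV[R]_3) :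
  0 < c -> normalize (c *: v) = normalize v.
Proof.
move=> c_gt0; rewrite /normalize norm2Z ?ltW // scalerA; congr (_ *: _).
by rewrite invfM mulrAC mulVf ?mul1r // gt_eqF.
Qed.

Lemma norm2_normalize (R : realType) (v : 'cV[R]_3) :
  v != 0 -> norm2 (normalize v) = 1.
Proof.
move=> v0; have n_gt0 := norm2_gt0 _ _ v0.
by rewrite norm2Z ?invr_ge0 ?ltW // mulVf // gt_eqF.
Qed.

Lemma normalize_id (R : realType) (v : 'cV[R]_3) :
  norm2 v = 1 -> normalize v = v.
Proof. by rewrite /normalize => ->; rewrite invr1 scale1r. Qed.

Lemma dotvv_continuous (R : realType) : continuous (fun x : 'cV[R]_3 => dot x x).
Proof.
move=> v; rewrite /continuous_at /dot sum3.
have -> : (fun x : 'cV[R]_3 => \sum_(i < 3) x i 0 * x i 0) =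
    fun x => x 0 0 * x 0 0 + x 1 0 * x 1 0 + x 2%:R 0 * x 2%:R 0.
  by apply/funext => x; rewrite sum3.
have sq i : (fun x : 'cV[R]_3 => x i 0 * x i 0) @ v --> v i 0 * v i 0.
  have c : (fun x : 'cV[R]_3 => x i 0) @ v --> v i 0 by exact: coord_continuous.
  exact: (cvgM c c).
exact: (cvgD (cvgD (sq 0) (sq 1)) (sq 2%:R)).
Qed.

Lemma normalize_continuous (R : realType) (v : 'cV[R]_3) :
  v != 0 -> {for v, continuous (@normalize R)}.
Proof.
move=> v0; have n_gt0 := norm2_gt0 _ _ v0.
have cn : norm2 x @[x --> v] --> norm2 v.
  apply: (@continuous_comp _ _ _ (fun x => dot x x) Num.sqrt).
    exact: dotvv_continuous.
  exact: sqrt_continuous.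
apply: (@cvg_coord R _ _ (nbhs_filter v) (@normalize R)) => i.
rewrite [X in _ --> X]mxE.
under eq_fun do rewrite mxE.
by apply: cvgM; [apply: cvgV => //; rewrite gt_eqF|exact: coord_continuous].
Qed.

(** * The cone and uniform convergence of directions *)

Lemma cone_mmp_neq0 (R : realType) (w : 'cV[R]_3) : cone_mmp w -> w != 0.
Proof. by case=> w0 _ _; apply: contraTneq w0 => ->; rewrite mxE ltxx. Qed.

Lemma cone_mmpZ (R : realType) c (w : 'cV[R]_3) :
  0 < c -> cone_mmp w -> cone_mmp (c *: w).
Proof.
move=> c_gt0 [w0 w1 w2].
by split; rewrite mxE ?pmulr_rlt0 ?pmulr_rgt0.
Qed.

Lemma cone_mmp_normalize (R : realType) (w : 'cV[R]_3) :
  cone_mmp w -> cone_mmp (normalize w).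
Proof.
move=> cw; apply: cone_mmpZ (cw).
by rewrite invr_gt0 norm2_gt0 // cone_mmp_neq0.
Qed.

Lemma signs_mulK (R : realType) (w : 'cV[R]_3) : signs R *m (signs R *m w) = w.
Proof. by rewrite mulmxA signsK mul1mx. Qed.

Lemma inv_transpose_prodA_mul (R : realType) n k (w : 'cV[R]_3) :
  inv_transpose (prodA R n k) *m w =
  signs R *m (prodB R n k *m (signs R *m w)).
Proof. by rewrite inv_transpose_prodA !mulmxA. Qed.

(** Normalization ignores positive scaling, so the image of [w] may first be divided by its last
    coordinate. It is then close to [v] uniformly in [w], and continuity of [normalize] at [v]
    concludes. *)
Lemma uniform_direction (R : realType) n : (forall i, 0 < n i)%N ->
  exists ell : 'cV[R]_3, [/\ norm2 ell = 1, cone_mmp ell &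
    forall e : R, 0 < e -> \forall k \near \oo, forall w, cone_mmp w ->
      ball ell e (normalize (inv_transpose (prodA R n k) *m w))].
Proof.
move=> n_gt0; have [t [t_gt0 ht]] := prodB_direction R n n_gt0.
pose v : 'cV[R]_3 := signs R *m \col_i t i.
have cv : cone_mmp v.
  by apply/cone_mmpE => i; rewrite /v signs_mulK mxE.
have v0 := cone_mmp_neq0 _ _ cv.
exists (normalize v); split; [exact: norm2_normalize|exact: cone_mmp_normalize|].
move=> e e_gt0.
have /cvg_ballP/(_ e e_gt0)/nbhs_ballP[d d_gt0 hd] := normalize_continuous _ _ v0.
have := ht d d_gt0; apply: filterS => k hk w /cone_mmpE w_gt0.
rewrite inv_transpose_prodA_mul.
set u := prodB R n k *m (signs R *m w).
have [u2_gt0 _] := hk 0 _ w_gt0; rewrite -/u in u2_gt0.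
rewrite -(normalizeZ _ (u 2%:R 0)^-1 (signs R *m u)) ?invr_gt0 //.
apply: hd; split=> // i j; rewrite (ord1 j).
rewrite [X in ball _ _ X]mxE /v !signs_coord [X in _ * X]mxE.
have [_] := hk i _ w_gt0; rewrite -/u /ball /= distrC => h.
rewrite mulrCA -mulrBr normrM -[ltRHS]mul1r mulrC.
have -> : `|(if (i < 2)%N then -1 else 1) : R| = 1.
  by case: ifP; rewrite ?normrN normr1.
by rewrite mulr1 mul1r (mulrC _ (u i 0)).
Qed.

(** * The stable eigenvector of a finite product *)

Lemma prodA_add (R : realType) n a b :
  prodA R n (a + b) = prodA R n a *m prodA R (fun i => n (a + i)%N) b.
Proof.
elim: b => [|b IH]; first by rewrite addn0 /prodA big_ord0 mulmx1.
by rewrite addnS !prodAS IH mulmxA.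
Qed.

Lemma inv_transpose_cone (R : realType) n k (w : 'cV[R]_3) :
  (forall i, 0 < n i)%N -> (3 <= k)%N ->
  cone_mmp w -> cone_mmp (inv_transpose (prodA R n k) *m w).
Proof.
move=> n_gt0 k3 /cone_mmpE w_gt0; apply/cone_mmpE => i.
rewrite inv_transpose_prodA_mul signs_mulK mxE sum3.
have P_gt0 j : 0 < prodB R n k i j by rewrite (lt_le_trans ltr01) ?prodB_ge1.
by rewrite !addr_gt0 ?mulr_gt0.
Qed.

(* The eigenvector is the limit direction of the [k]-periodic sequence. *)
Lemma cone_eigenvector (R : realType) n k :
  (forall i, 0 < n i)%N -> (3 <= k)%N ->
  exists ell : 'cV[R]_3, [/\ norm2 ell = 1, cone_mmp ell &
    normalize (inv_transpose (prodA R n k) *m ell) = ell].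
Proof.
(* Repeating the first [k] terms makes the product of k j factors the j-th power of
   [prodA R n k]. *)
move=> n_gt0 k3; pose n' i := n (i %% k)%N.
have [|ell [ell1 cell hell]] := uniform_direction R n'.
  by move=> i; exact: n_gt0.
exists ell; split=> //.
set Q := inv_transpose (prodA R n k).
pose w : 'cV[R]_3 := signs R *m const_mx 1.
have cw : cone_mmp w by apply/cone_mmpE => i; rewrite signs_mulK mxE.
pose x j := normalize (inv_transpose (prodA R n' (k * j)) *m w).
have xl : x j @[j --> \oo] --> ell.
  apply/cvg_ballP => e e_gt0; have [K _ hK] := hell e e_gt0.
  exists K => // j /= Kj; apply: hK => //=.
  by rewrite (leq_trans Kj) // leq_pmull // (leq_trans _ k3).
have xS j : x j.+1 = normalize (Q *m x j).
  rewrite /x mulnS prodA_add inv_transposeM ?unitmx_prodA //.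
  have -> : prodA R n' k = prodA R n k.
    by apply: eq_bigr => i _; rewrite /n' modn_small.
  have -> : (fun i => n' (k + i)%N) = n'.
    by apply/funext => i; rewrite /n' modnDl.
  rewrite -mulmxA -/Q; set z := inv_transpose _ *m w.
  (* For j = 0 the product is empty; otherwise it has at least k >= 3 factors and preserves the
     cone. *)
  have cz : cone_mmp z \/ z = w.
    case: j @z => [|j] z.
      by right; rewrite /z muln0 /prodA big_ord0 /inv_transpose invmx1 trmx1 mul1mx.
    left; apply: inv_transpose_cone => //; first by move=> i; exact: n_gt0.
    by rewrite mulnS (leq_trans k3) // leq_addr.
  have {}cz : cone_mmp z by case: cz => // ->.
  rewrite /normalize -scalemxAr -/(normalize _) -/(normalize _) normalizeZ //.
  by rewrite invr_gt0 norm2_gt0 // cone_mmp_neq0.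
have Q0 : Q *m ell != 0 by apply/cone_mmp_neq0/inv_transpose_cone.
(* Passing to the limit in the recursion [xS] shows that [ell] is fixed by the normalized action of
   [Q]. *)
have xSl : x j.+1 @[j --> \oo] --> normalize (Q *m ell).
  under eq_fun do rewrite xS.
  apply: (@cvg_comp _ _ _ (fun j => Q *m x j)); last exact: normalize_continuous.
  by apply: cvg_comp xl _; exact: mulmx_continuous.
apply/esym; apply: (@cvg_unique _ (@norm_hausdorff _ _) (x @ \oo)) => //.
by rewrite cvg_shiftS in xSl.
Qed.

(* Compare [a] with [y] at an index where [a i / y i] is maximal. *)
Lemma perron_comparison (R : realType) (P : 'M[R]_3) (y a : 'I_3 -> R) rho z :
  (forall i j, 0 <= P i j) -> (forall i, 0 < y i) -> 0 <= z ->
  (forall i, \sum_j P i j * y j = rho * y i) ->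
  (exists i, 0 < a i) ->
  (forall i, a i <= z * \sum_j P i j * a j) ->
  1 <= z * rho.
Proof.
move=> P_ge0 y_gt0 z_ge0 Py [i0 ai0] aP.
have [i _ hi] := @arg_maxP _ _ _ i0 xpredT (fun i => a i / y i) erefl.
set c := a i / y i in hi; have le_c j : a j / y j <= c := hi j erefl.
have c_gt0 : 0 < c by rewrite (lt_le_trans _ (le_c i0)) // divr_gt0.
have a_le j : a j <= c * y j by rewrite -ler_pdivrMr // le_c.
have ai : a i = c * y i by rewrite /c divfK // gt_eqF.
have := aP i; rewrite ai => h.
have {}h : c * y i <= z * (c * (rho * y i)).
  apply: le_trans h _; apply: ler_wpM2l => //.
  rewrite -Py mulr_sumr; apply: ler_sum => j _.
  by rewrite mulrCA ler_wpM2l.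
have cy_gt0 : 0 < c * y i by rewrite mulr_gt0.
by rewrite -(ler_pM2r cy_gt0) mul1r (le_trans h) // le_eqVlt;
  apply/orP; left; apply/eqP; ring.
Qed.

(** The fixed direction [m] is an eigenvector of the inverse transpose for some rho > 1, hence of
    the transpose for 1/rho. Comparison with the positive vector [y] excludes complex eigenvalues of
    modulus below 1/rho. *)
Lemma is_stable_eigenvector_exists (R : realType) n k :
  (forall i, 0 < n i)%N -> (3 <= k)%N ->
  exists m : 'cV[R]_3, is_stable_eigenvector (prodA R n k) m.
Proof.
move=> n_gt0 k3; have [m [m1 cm hm]] := cone_eigenvector R n k n_gt0 k3.
set M := prodA R n k in hm *; set Q := inv_transpose M in hm.
have uM : M \in unitmx := unitmx_prodA R n k.
have cQ : cone_mmp (Q *m m) := inv_transpose_cone R n k m n_gt0 k3 cm.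
set rho := norm2 (Q *m m); have rho_gt0 : 0 < rho.
  by rewrite norm2_gt0 // cone_mmp_neq0.
have Qm : Q *m m = rho *: m.
  by rewrite -[in RHS]hm /normalize scalerA mulfV ?scale1r // gt_eqF.
have P_ge1 i j : 1 <= prodB R n k i j := prodB_ge1 R n k i j n_gt0 k3.
have P_ge0 i j : 0 <= prodB R n k i j by rewrite (le_trans ler01).
pose y i := (signs R *m m) i 0.
have y_gt0 i : 0 < y i by move/cone_mmpE: cm; apply.
have Py i : \sum_j prodB R n k i j * y j = rho * y i.
  have : prodB R n k *m (signs R *m m) = rho *: (signs R *m m).
    by rewrite scalemxAr -Qm inv_transpose_prodA_mul signs_mulK.
  by move=> /matrixP/(_ i 0); rewrite mxE [RHS]mxE.
(* Entries at least 1 give rho y_0 >= y_0 + y_1 + y_2 > y_0. *)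
have rho_gt1 : 1 < rho.
  rewrite -(ltr_pM2r (y_gt0 0)) mul1r -Py sum3.
  have le1 j : y j <= prodB R n k 0 j * y j by rewrite ler_peMl // ltW.
  have := le1 0; have := le1 1; have := le1 2%:R.
  have := y_gt0 1; have := y_gt0 2%:R; lra.
have Mm : M^T *m m = rho^-1 *: m.
  have <- : M^T *m (rho^-1 *: (Q *m m)) = rho^-1 *: m.
    rewrite -scalemxAr mulmxA /Q /inv_transpose -trmx_mul mulVmx // trmx1.
    by rewrite mul1mx.
  by rewrite Qm scalerA mulVf ?scale1r // gt_eqF.
exists m, rho^-1; split=> //.
  by rewrite invr_gt0 rho_gt0 invf_lt1.
split.
  apply/eigenvalueP; exists m^T; last by rewrite trmx_eq0 cone_mmp_neq0.
  by rewrite -[M]trmxK -trmx_mul Mm; apply/matrixP => i j; rewrite !mxE.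
move=> z /eigenvalueP[v vM v0].
have normCE (x : R[i]) : `|x| = real_complex R (Normc.normc x) by [].
rewrite !normCE lecR; set c := map_mx _ M in vM.
(* Taking moduli in this identity gives a <= |z| P a coordinatewise with P = [prodB R n k], the
   inequality needed for the comparison. *)
have vE : v = z *: (v *m map_mx (real_complex R) (invmx M)).
  by rewrite scalemxAl -vM -mulmxA -map_mxM mulmxV // map_mx1 mulmx1.
pose a j := Normc.normc (v 0 j).
have normc_ge0 (x : R[i]) : 0 <= Normc.normc x.
  by case: x => ? ?; exact: sqrtr_ge0.
have normc_real (x : R) : Normc.normc (real_complex R x) = `|x|.
  by rewrite /= expr0n addr0 sqrtr_sqr.
(* Conjugation by [signs] changes only the signs of the entries. *)
have invE i j : `|invmx M j i| = prodB R n k i j.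
  have -> : invmx M j i = Q i j by rewrite /Q /inv_transpose mxE.
  rewrite /Q inv_transpose_prodA mul_mx_diag mul_diag_mx !mxE.
  rewrite !normrM (ger0_norm (P_ge0 i j)).
  by do 2 case: ifP => _; rewrite ?normrN normr1 mul1r mulr1.
have aP i : a i <= Normc.normc z * \sum_j prodB R n k i j * a j.
  rewrite {1}/a {1}vE mxE Normc.normcM ler_wpM2l //.
  rewrite -lecR -normCE mxE (le_trans (ler_norm_sum _ _ _)) // rmorph_sum /=.
  apply: ler_sum => j _.
  by rewrite !mxE normrM !normCE -rmorphM lecR normc_real invE mulrC.
have [j aj] : exists j, 0 < a j.
  apply: contrapT => /forallNP a0; case/eqP: v0; apply/matrixP => i j.
  rewrite (ord1 i) mxE; apply: Normc.eq0_normc; apply/le_anti.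
  by rewrite normc_ge0 andbT leNgt; apply/negP/a0.
have h := perron_comparison R _ y a rho _ P_ge0 y_gt0 (normc_ge0 z) Py
  (ex_intro _ j aj) aP.
rewrite normc_real gtr0_norm ?invr_gt0 //.
by rewrite -[leLHS]mul1r ler_pdivrMr.
Qed.

(** Every stable eigenvector is a normalized point of the image of the cone, so the uniform estimate
    applies to it with [w] equal to the eigenvector itself. *)
Lemma stable_eigenvector_fixed (R : realType) n k (m : 'cV[R]_3) :
  is_stable_eigenvector (prodA R n k) m ->
  cone_mmp m /\ normalize (inv_transpose (prodA R n k) *m m) = m.
Proof.
move=> [lam [/andP[lam_gt0 _] _ Mm m1 cm]]; split=> //.
set M := prodA R n k in Mm *.
have uM : M \in unitmx := unitmx_prodA R n k.
have -> : inv_transpose M *m m = lam^-1 *: m.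
  have e : inv_transpose M *m (lam *: m) = m.
    by rewrite -Mm mulmxA /inv_transpose -trmx_mul mulmxV // trmx1 mul1mx.
  by rewrite -[in RHS]e -scalemxAr scalerA mulVf ?scale1r // gt_eqF.
by rewrite normalizeZ ?invr_gt0 // normalize_id.
Qed.

(** * From convergence of vectors to convergence of covectors *)

Lemma coord_le_norm2 (R : realType) (w : 'cV[R]_3) i : `|w i 0| <= norm2 w.
Proof.
rewrite -sqrtr_sqr ler_sqrt /dot; last first.
  by apply: sumr_ge0 => j _; rewrite -expr2 sqr_ge0.
rewrite (bigD1 i) //= -expr2 lerDl sumr_ge0 // => j _.
by rewrite -expr2 sqr_ge0.
Qed.

(** Balls are for the sup norm and the coordinates of [w] are at most 1 in modulus, so each of the
    three terms contributes less than [e]. *)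
Lemma dot_dist_lt (R : realType) (u v w : 'cV[R]_3) (e : R) :
  norm2 w <= 1 -> ball u e v -> `|dot u w - dot v w| < 3 * e.
Proof.
move=> w1 [e_gt0 uv]; rewrite /dot -sumrB (le_lt_trans (ler_norm_sum _ _ _)) //.
have lt_e i : `|u i 0 * w i 0 - v i 0 * w i 0| < e.
  rewrite -mulrBl normrM; apply: (@le_lt_trans _ _ `|u i 0 - v i 0|).
    by rewrite ler_piMr // (le_trans (coord_le_norm2 _ _ _)).
  exact: uv.
by rewrite sum3; have := lt_e 0; have := lt_e 1; have := lt_e 2%:R; lra.
Qed.

(* Convergence of linear functionals is convergence in the dual norm, i.e.
   uniform convergence on the Euclidean unit ball. *)
Theorem theorem7p3 (R : realType) (n : nat -> nat)
    (n_gt0 : forall i : nat, (0 < n i)%N) :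
  exists ell : 'cV[R]_3,
    [/\ norm2 ell = 1,
        cone_mmp ell,
        forall w : 'cV[R]_3, cone_mmp w ->
          normalize (inv_transpose (prodA R n k) *m w) @[k --> \oo] --> ell
      & {uniform @unit_ball2 R,
          (fun k : nat => stable_covector (prodA R n k)) @ \oo --> dot ell}].
Proof.
have [ell [ell1 cell hell]] := uniform_direction R n n_gt0.
exists ell; split=> //.
  move=> w cw; apply/cvg_ballP => e e_gt0.
  by apply: filterS (hell e e_gt0) => k; exact.
move=> P /uniform_nbhs[E [/= entE EP]].
move: entE; rewrite -entourage_ballE => -[e /= e_gt0 eE].
(* The division by 3 absorbs the factor in [dot_dist_lt]. *)
have e3_gt0 : 0 < e / 3 by rewrite divr_gt0.
have [K _ hK] := hell _ e3_gt0.
(* From k = 3 on a stable eigenvector exists, so [xget] returns one instead of its default 0. *)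
exists (maxn K 3) => // k /=; rewrite geq_max => /andP[Kk k3].
apply: EP => w /= w1; apply: eE => /=.
have [cm fm] := stable_eigenvector_fixed R n k _
  (xgetPex 0 (is_stable_eigenvector_exists R n k n_gt0 k3)).
have := hK k Kk _ cm; rewrite fm => h.
by have := dot_dist_lt R _ _ w _ w1 h; rewrite mulrC divfK.
Qed.
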